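(* Let $\mathcal{H}$ be a complex Hilbert space and let $T_1,T_2\in\mathcal{B}(\mathcal{H})$ be contractions such that $A_{T_1}=A_{T_2}=A$. Then $A\leq A_{T_1T_2}$.
   Context: For a contraction $T\in\mathcal{B}(\mathcal{H})$ (i.e. $\|T\|\leq1$), the asymptotic limit of $T$ is $A_T:=\lim_{n\to\infty}T^{*n}T^n$, the limit being in the strong operator topology (it exists since the sequence is decreasing and positive). The inequality is the usual order on self-adjoint operators. *)

(* Defs.v *)
From HB Require Import structures.
From mathcomp Require Import all_boot all_order all_algebra.
From mathcomp Require Import complex.
From mathcomp Require Import all_classical all_reals all_analysis.

Set Implicit Arguments.
Unset Strict Implicit.
Unset Printing Implicit Defensive.

Import Order.TTheory GRing.Theory Num.Theory.
Import numFieldNormedType.Exports.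

Local Open Scope classical_set_scope.
Local Open Scope ring_scope.
Local Open Scope complex_scope.

(* A form in [{dot H for Num.conj}] is positive definite and Hermitian, linear
   on the left and conjugate-linear on the right. *)
HB.mixin Record isHilbert (R : realType) H of CompleteNormedModule R[i] H := {
  inner : {dot H for @Num.conj R[i]} ;
  inner_norm : forall x : H, inner x x = `|x| ^+ 2 }.

#[short(type="hilbertType")]
HB.structure Definition Hilbert (R : realType) :=
  { H of CompleteNormedModule R[i] H & isHilbert R H }.

Record boundedOp (R : realType) (H : hilbertType R) := BoundedOp {
  boundedOp_fun :> {linear H -> H} ;
  boundedOp_bounded : bounded_near boundedOp_fun (nbhs (0 : H)) }.
Arguments boundedOp {R} H.

HB.instance Definition _ (R : realType) (H : hilbertType R) :=
  gen_eqMixin (boundedOp H).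
HB.instance Definition _ (R : realType) (H : hilbertType R) :=
  gen_choiceMixin (boundedOp H).

Section operators.
Context {R : realType} {H : hilbertType R}.
Implicit Types S T A B : boundedOp H.

Lemma zero_bounded : bounded_near (\0 : {linear H -> H}) (nbhs (0 : H)).
Proof. by apply/linear_bounded_continuous => x; exact: cvg_cst. Qed.

Definition zero_op : boundedOp H := BoundedOp zero_bounded.

HB.instance Definition _ := isPointed.Build (boundedOp H) zero_op.

Lemma comp_bounded S T :
  bounded_near (S \o T : {linear H -> H}) (nbhs (0 : H)).
Proof.
apply/linear_bounded_continuous => x; apply: continuous_comp.
- by move: x; apply/linear_bounded_continuous; exact: boundedOp_bounded.
- by move: (T x); apply/linear_bounded_continuous; exact: boundedOp_bounded.
Qed.

Definition comp_op S T : boundedOp H := BoundedOp (comp_bounded S T).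

(* The norm of [H] takes values in [R[i]], where it is a nonnegative real;
   [complex.Re] brings it back to [R]. *)
Definition op_norm T : R :=
  sup [set complex.Re `|T x| | x in [set x : H | `|x| <= 1]].

Definition contractive T := op_norm T <= 1.

(* [get] picks an element of the set (here there is exactly one), and returns
   [zero_op] on the empty set. *)
Definition adjoint T : boundedOp H :=
  get [set S : boundedOp H | forall x y : H, inner (T x) y = inner x (S y)].

Definition sot_cvg (T_ : nat -> boundedOp H) A :=
  forall x : H, T_ n x @[n --> \oo] --> A x.

Lemma id_bounded : bounded_near (idfun : {linear H -> H}) (nbhs (0 : H)).
Proof. by apply/linear_bounded_continuous => x; exact: cvg_id. Qed.

Definition id_op : boundedOp H := BoundedOp id_bounded.

Definition pow_op T n : boundedOp H := iter n (comp_op T) id_op.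

(* For a contraction [T] the strong limit exists and is unique. *)
Definition asymptotic_limit T : boundedOp H :=
  get [set A : boundedOp H |
    sot_cvg (fun n => comp_op (pow_op (adjoint T) n) (pow_op T n)) A].

(* In [R[i]], [0 <= z] says that [z] is real and nonnegative. *)
Definition op_le A B := forall x : H, 0 <= inner (B x - A x) x.

End operators.

(* Main.v *)
Require Import Defs.
From HB Require Import structures.
From mathcomp Require Import all_boot all_order all_algebra.
From mathcomp Require Import complex ring lra.
From mathcomp Require Import all_classical all_reals all_analysis.

(* Taking the limit of <T*^n T^n x, x> = |T^n x|^2 shows that the form
   <A_T x, x> is unchanged when x is replaced by T x, and that it is at most
   |x|^2.  Hence <A x, x> is invariant under T1 and T2, so under S = T1 T2, and
   <A x, x> = <A S^n x, S^n x> <= |S^n x|^2, which tends to <A_S x, x>.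

   The operators chosen in the definitions have to be shown to exist.  The
   adjoint comes from Riesz representation, proved by minimising
   |x|^2 - 2 L x.  For the strong limit of W_n = T*^n T^n, one has
   |W_m x - W_n x|^2 <= |T^m x|^2 - |T^n x|^2 for m <= n. *)

Set Implicit Arguments.
Unset Strict Implicit.
Unset Printing Implicit Defensive.

Import Order.TTheory GRing.Theory Num.Theory.
Import numFieldNormedType.Exports.

Local Open Scope classical_set_scope.
Local Open Scope ring_scope.
Local Open Scope complex_scope.

(** * The underlying real inner product and convergence *)

Section real_inner.
Context {R : realType} {H : hilbertType R}.
Implicit Types x y z : H.

(** A real-valued form gives access to real limits, infima and [lra]; [inner_rip] recovers the
    complex form from it. *)
Definition rip x y : R := complex.Re (inner x y).
Definition nsq x : R := rip x x.

Lemma innerC x y : inner x y = (inner y x)^*%C.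
Proof. by rewrite (hermC inner) expr0 mul1r. Qed.

Lemma ripC x y : rip x y = rip y x.
Proof. by rewrite /rip innerC; case: (inner y x). Qed.

Lemma ripDl x y z : rip (x + y) z = rip x z + rip y z.
Proof.
rewrite /rip (linearDl inner z x y : inner (x + y) z = inner x z + inner y z).
by case: (inner x z) => ? ?; case: (inner y z).
Qed.

Lemma ripNl x z : rip (- x) z = - rip x z.
Proof.
rewrite /rip (linearNl inner z x : inner (- x) z = - inner x z).
by case: (inner x z).
Qed.

Lemma ripZl (a : R) x z : rip (a%:C *: x) z = a * rip x z.
Proof.
rewrite /rip.
rewrite (linearZl_LR inner z a%:C x : inner (a%:C *: x) z = a%:C * inner x z).
case: (inner x z) => u v /=; ring.
Qed.

Lemma ripDr x y z : rip z (x + y) = rip z x + rip z y.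
Proof. by rewrite !(ripC z) ripDl. Qed.

Lemma ripNr x z : rip z (- x) = - rip z x.
Proof. by rewrite !(ripC z) ripNl. Qed.

Lemma ripZr (a : R) x z : rip z (a%:C *: x) = a * rip z x.
Proof. by rewrite !(ripC z) ripZl. Qed.

Definition ripE := (ripDl, ripDr, ripNl, ripNr, ripZl, ripZr).

(** Conjugate-linearity on the right produces the factor [-i], whose product with [u + iv] has real
    part [v]. *)
Lemma Im_inner x y : complex.Im (inner x y) = rip x ('i%C *: y).
Proof.
rewrite /rip (linearZr_LR inner x 'i%C y :
  inner x ('i%C *: y) = ('i%C)^*%C * inner x y).
case: (inner x y) => u v /=; ring.
Qed.

Lemma inner_rip x y : inner x y = rip x y +i* rip x ('i%C *: y).
Proof. by rewrite -Im_inner /rip; case: (inner x y). Qed.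

Lemma ripil x y : rip ('i%C *: x) y = - rip x ('i%C *: y).
Proof.
rewrite -Im_inner /rip.
rewrite (linearZl_LR inner y 'i%C x : inner ('i%C *: x) y = 'i%C * inner x y).
case: (inner x y) => u v /=; ring.
Qed.

Lemma sqr_norm_nsq x : `|x| ^+ 2 = (nsq x)%:C.
Proof.
rewrite -inner_norm inner_rip /nsq; congr (_ +i* _).
rewrite -Im_inner; apply: ger0_Im; rewrite inner_norm; exact: exprn_ge0.
Qed.

Lemma nsq_ge0 x : 0 <= nsq x.
Proof. by rewrite -ler0c -sqr_norm_nsq exprn_ge0. Qed.

Lemma nsq_eq0 x : nsq x = 0 -> x = 0.
Proof.
move=> x0; apply/eqP; rewrite -normr_eq0 -sqrf_eq0 sqr_norm_nsq x0; exact/eqP.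
Qed.

Lemma norm_le_nsq x (e : R) : 0 <= e -> (`|x| <= e%:C) = (nsq x <= e ^+ 2).
Proof.
move=> e0; rewrite -(@ler_pXn2r _ 2) ?nnegrE ?ler0c//.
by rewrite sqr_norm_nsq -rmorphXn lecR.
Qed.

Lemma norm_lt_nsq x (e : R) : 0 <= e -> (`|x| < e%:C) = (nsq x < e ^+ 2).
Proof.
move=> e0; rewrite -(@ltr_pXn2r _ 2) ?nnegrE ?ler0c//.
by rewrite sqr_norm_nsq -rmorphXn ltcR.
Qed.

Lemma rip_ext x y : (forall z, rip z x = rip z y) -> x = y.
Proof.
move=> xy; apply/subr0_eq/nsq_eq0.
by rewrite /nsq ripDr ripNr xy subrr.
Qed.

Lemma nsqB x y : nsq (x - y) = nsq x - 2 * rip x y + nsq y.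
Proof. rewrite /nsq !ripE (ripC y x); ring. Qed.

Lemma rip_CauchySchwarz x y : rip x y ^+ 2 <= nsq x * nsq y.
Proof.
have [y0|y0] := eqVneq (nsq y) 0.
  rewrite (nsq_eq0 y0) -(scale0r (0 : H)) -[0]/(0%:C) ripZr mul0r expr0n /=.
  by rewrite mulr_ge0 ?nsq_ge0.
have yp : 0 < nsq y by rewrite lt_def y0 nsq_ge0.
rewrite -subr_ge0 -(pmulr_rge0 _ yp).
(* This square expands to [nsq y * (nsq x * nsq y - rip x y ^+ 2)]. *)
have := nsq_ge0 ((nsq y)%:C *: x - (rip x y)%:C *: y).
by rewrite nsqB /nsq !ripE; lra.
Qed.

Lemma cvg_nsqP (u : nat -> H) l : u @ \oo --> l <->
  (forall e : R, 0 < e -> \forall n \near \oo, nsq (l - u n) < e).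
Proof.
rewrite cvgrPdist_lt; split => ul e e0.
  have s0 : 0 < Num.sqrt e by rewrite sqrtr_gt0.
  have := ul (Num.sqrt e)%:C; rewrite ltcR => /(_ s0).
  by apply: filterS => n; rewrite norm_lt_nsq ?(ltW s0)// sqr_sqrtr ?(ltW e0).
(* Here [e] ranges over [R[i]]; being positive, it is real. *)
have eR : e = (complex.Re e)%:C by rewrite RRe_real// gtr0_real.
move: e0; rewrite eR ltcR => e0.
have := ul _ (exprn_gt0 2 e0).
by apply: filterS => n; rewrite norm_lt_nsq ?(ltW e0).
Qed.

Lemma cauchy_nsq_cvg (u : nat -> H) :
  (forall e : R, 0 < e -> exists n0, forall n, (n0 <= n)%N ->
    nsq (u n0 - u n) < e) -> exists l : H, u @ \oo --> l.
Proof.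
move=> cu; suff : cvg (u @ \oo) by move=> c; exists (lim (u @ \oo)).
apply/cauchy_cvgP/cauchy_exP => e e0.
have eR : e = (complex.Re e)%:C by rewrite RRe_real// gtr0_real.
move: e0; rewrite eR ltcR => e0.
have [n0 un0] := cu _ (exprn_gt0 2 e0).
exists (u n0); exists n0 => // n /= n0n.
by rewrite -ball_normE /= norm_lt_nsq ?(ltW e0)// un0.
Qed.

Lemma cvg_rip (u : nat -> H) l y : u @ \oo --> l ->
  rip (u n) y @[n --> \oo] --> rip l y.
Proof.
move=> /cvg_nsqP ul; apply/cvgrPdist_lt => e e0.
have c0 : 0 < nsq y + 1 by have := nsq_ge0 y; lra.
have := ul _ (divr_gt0 (exprn_gt0 2 e0) c0); apply: filterS => n.
rewrite ltr_pdivlMr// => h.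
rewrite -(@ltr_pXn2r _ 2) ?nnegrE ?(ltW e0)// real_normK ?num_real//.
rewrite -ripNl -ripDl; apply: le_lt_trans (rip_CauchySchwarz _ _) _.
apply: le_lt_trans h; apply: ler_wpM2l; [exact: nsq_ge0 | lra].
Qed.

End real_inner.

(** * Riesz representation, bounds on operators and the adjoint *)

Section adjoint.
Context {R : realType} {H : hilbertType R}.
Implicit Types (x y z w : H) (S T : boundedOp H).

(** Real-linear functionals suffice, as the intended one is [x |-> rip (T x) y]; the minimiser of
    [J] represents [L]. *)
Lemma riesz_representation (L : H -> R) (K : R) : 0 <= K ->
  {morph L : x y / x + y} -> (forall (a : R) x, L (a%:C *: x) = a * L x) ->
  (forall x, L x ^+ 2 <= K * nsq x) -> exists z, forall x, L x = rip x z.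
Proof.
move=> K0 LD LZ LK.
pose J x := nsq x - 2 * L x.
have J_ge x : - K <= J x.
  rewrite /J; have := LK x; have := nsq_ge0 x.
  move: (nsq x) (L x) => a l a0 la.
  rewrite leNgt; apply/negP => h.
  (* Together with [l ^+ 2 <= K * a] this would give [(a + K) ^+ 2 < 4 * K * a]. *)
  have : (a + K) ^+ 2 < (2 * l) ^+ 2 by rewrite ltr_pXn2r ?nnegrE//; lra.
  have := sqr_ge0 (a - K); lra.
have infJ : has_inf (range J).
  by split; [exists (J 0), 0 | exists (- K) => _ [x _ <-]].
pose m := inf (range J).
have mJ x : m <= J x by apply: ge_inf; [case: infJ | exists x].
(* By the parallelogram law, [nsq (x - y)] is [2 * (J x + J y)] minus four times [J] at the
   midpoint. *)
have Jclose x y e : J x < m + e -> J y < m + e -> nsq (x - y) < 4 * e.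
  move=> Jx Jy.
  have := mJ ((2^-1)%:C *: (x + y)); move: Jx Jy.
  rewrite nsqB /J /nsq !ripE LZ LD (ripC y x); lra.
(* Half the derivative of [J] at [x] along [w] is [d]. A step of length [s] against it lowers [J] by
   [d * s + s ^+ 2], which must stay below [e]; the [+ 1] keeps the divisor positive. *)
have Jgrad x w e : J x < m + e -> (rip x w - L w) ^+ 2 < e * (nsq w + 1).
  move=> Jx; set d := rip x w - L w.
  have w0 := nsq_ge0 w; have c0 : 0 < nsq w + 1 by lra.
  rewrite -ltr_pdivrMr//; set s := d / (nsq w + 1).
  have sd : s * (nsq w + 1) = d by rewrite /s divfK// gt_eqF.
  have := mJ (x - s%:C *: w).
  have LN : L (- (s%:C *: w)) = - (s * L w).
    by rewrite -scaleNr -rmorphN LZ mulNr.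
  rewrite /J /nsq !ripE LD LN (ripC w x) -/(nsq w) -/(nsq x) => h.
  have -> : d ^+ 2 / (nsq w + 1) = d * s by rewrite expr2 mulrA.
  move: Jx; rewrite /J.
  have : d = rip x w - L w by [].
  have : 0 <= s ^+ 2 by apply: sqr_ge0.
  move: sd h; move: (rip x w) (nsq w) (nsq x) (L w) (L x).
  move=> a b c l l' /= sd h s2 da Jx.
  have -> : d * s = 2 * (d * s) - s ^+ 2 * (b + 1) by rewrite -sd; ring.
  rewrite da; lra.
have /choice[u Ju] n : exists x, J x < m + n.+1%:R^-1.
  have n0 : 0 < n.+1%:R^-1 :> R by rewrite invr_gt0.
  by have [_ [x _ <-] Jx] := inf_adherent n0 infJ; exists x.
have [z uz] : exists z : H, u @ \oo --> z.
  apply: cauchy_nsq_cvg => e e0.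
  have e4 : 0 < e / 4 by lra.
  have [n0 _ hn0] := near_infty_natSinv_lt (PosNum e4).
  exists n0 => n n0n.
  suff : nsq (u n0 - u n) < 4 * (e / 4) by rewrite mulrC divfK.
  apply: Jclose; apply: lt_trans (Ju _) _; rewrite ltrD2l; apply: hn0 => //=.
exists z => w; rewrite ripC.
(* By [Jgrad] the derivative vanishes in the limit along the minimising sequence. *)
have uL : rip (u n) w @[n --> \oo] --> L w.
  apply/cvgrPdist_lt => e e0.
  have c0 : 0 < nsq w + 1 by have := nsq_ge0 w; lra.
  have := near_infty_natSinv_lt (PosNum (divr_gt0 (exprn_gt0 2 e0) c0)).
  apply: filterS => n /=; rewrite ltr_pdivlMr// => h.
  rewrite -(@ltr_pXn2r _ 2) ?nnegrE ?(ltW e0)// real_normK ?num_real//.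
  by rewrite -sqrrN opprB (lt_trans (Jgrad _ _ _ (Ju n))).
exact: (@cvg_unique _ _ _ _ _ _ uL (cvg_rip uz)).
Qed.

Lemma bounded_nsqP (f : {linear H -> H}) : bounded_near f (nbhs (0 : H)) <->
  exists2 K : R, 0 <= K & forall x, nsq (f x) <= K * nsq x.
Proof.
split=> [/linear_boundedP/pinfty_ex_gt0[r r0 fr]|[K K0 fK]].
  have rR : r = (complex.Re r)%:C by rewrite RRe_real// gtr0_real.
  exists (complex.Re r ^+ 2) => [|x]; first exact: sqr_ge0.
  rewrite -lecR rmorphM rmorphXn /= -rR -!sqr_norm_nsq -exprMn.
  by rewrite ler_pXn2r// nnegrE// mulr_ge0// ltW.
apply/linear_boundedP; exists (Num.sqrt K)%:C; split.
  by apply/complex_realP; exists (Num.sqrt K).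
move=> r /ltW Kr x; apply: (@le_trans _ _ ((Num.sqrt K)%:C * `|x|)).
  rewrite -(@ler_pXn2r _ 2) ?nnegrE ?mulr_ge0 ?ler0c ?sqrtr_ge0//.
  by rewrite exprMn !sqr_norm_nsq -rmorphXn -rmorphM /= lecR sqr_sqrtr.
by rewrite ler_wpM2r.
Qed.

Lemma contractive_nsq T x : contractive T -> nsq (T x) <= nsq x.
Proof.
move=> T1; have [x0|x0] := eqVneq (nsq x) 0.
  by rewrite (nsq_eq0 x0) linear0.
have xp : 0 < nsq x by rewrite lt_def x0 nsq_ge0.
have sp : 0 < Num.sqrt (nsq x) by rewrite sqrtr_gt0.
(* Scaling by [a] turns [x] into a unit vector. *)
pose a := (Num.sqrt (nsq x))^-1.
have aE : a ^+ 2 * nsq x = 1 by rewrite exprVn sqr_sqrtr ?ltW// mulVf.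
have [K K0 TK] := (bounded_nsqP T).1 (boundedOp_bounded T).
have nreal v : (complex.Re `|v : H|)%:C = `|v| by rewrite RRe_real.
(* [sup] bounds its set only if the set is bounded above, since otherwise it takes a default
   value. *)
have ub : has_ubound [set complex.Re `|T v| | v in [set v : H | `|v| <= 1]].
  exists (Num.sqrt K) => _ [v v1 <-].
  rewrite -lecR nreal norm_le_nsq ?sqrtr_ge0// sqr_sqrtr//.
  apply: le_trans (TK v) _; rewrite -[leRHS]mulr1 ler_wpM2l//.
  by move: v1; rewrite /= -[1]/(1%:C) norm_le_nsq// expr1n.
have nT : nsq (T (a%:C *: x)) <= 1.
  rewrite -(expr1n _ 2) -norm_le_nsq// -nreal lecR; apply: le_trans T1.
  apply: ub_le_sup => //; exists (a%:C *: x) => //=.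
  rewrite -[1]/(1%:C) norm_le_nsq// /nsq !ripE mulrA -expr2 -/(nsq x).
  by rewrite aE expr1n.
move: nT; rewrite linearZ /= /nsq !ripE mulrA -expr2 -aE ler_pM2l//.
by rewrite exprn_gt0// invr_gt0.
Qed.

(** Riesz representation of [x |-> rip (T x) y] gives the value at [y]; linearity and boundedness
    are then checked. *)
Lemma adjoint_exists T :
  exists S, forall x y, inner (T x) y = inner x (S y).
Proof.
have [K K0 TK] := (bounded_nsqP T).1 (boundedOp_bounded T).
have /choice[s sE] y : exists z, forall x, rip (T x) y = rip x z.
  apply: (@riesz_representation _ (K * nsq y)) => [|x x'|a x|x].
  - by rewrite mulr_ge0 ?nsq_ge0.
  - by rewrite linearD ripDl.
  - by rewrite linearZ ripZl.
  - apply: le_trans (rip_CauchySchwarz _ _) _.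
    by rewrite mulrAC ler_wpM2r ?nsq_ge0.
have inE x y : inner (T x) y = inner x (s y).
  rewrite [LHS]inner_rip [RHS]inner_rip -sE; congr (_ +i* _).
  (* For the imaginary parts, [i] is moved to the left argument and through [T]. *)
  by apply: oppr_inj; rewrite -!ripil -sE linearZ.
have slin : linear s.
  move=> a y y'; apply: rip_ext => x.
  suff : inner x (s (a *: y + y')) = inner x (a *: s y + s y').
    by rewrite /rip => ->.
  have innerP v u u' :
    inner v (a *: u + u') = a^*%C * inner v u + inner v u'.
    exact: (linearPr inner v a u u').
  by rewrite innerP -!inE innerP.
pose s' : {linear H -> H} := HB.pack s (GRing.isLinear.Build _ _ _ _ _ slin).
have sb : bounded_near s' (nbhs (0 : H)).
  apply/bounded_nsqP; exists K => // y /=.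
  (* This bounds [nsq (s y) ^+ 2] by [K * nsq (s y) * nsq y]; one factor [nsq (s y)] then
     cancels. *)
  have := rip_CauchySchwarz (T (s y)) y; rewrite sE -/(nsq _) => h.
  have [->|y0] := eqVneq (nsq (s y)) 0; first by rewrite mulr_ge0 ?nsq_ge0.
  have yp : 0 < nsq (s y) by rewrite lt_def y0 nsq_ge0.
  rewrite -(ler_pM2l yp) -expr2; apply: le_trans h _.
  by rewrite mulrCA mulrA ler_wpM2r ?nsq_ge0.
by exists (BoundedOp sb).
Qed.

Lemma adjointE T x y : inner (T x) y = inner x (adjoint T y).
Proof. exact: (getPex (adjoint_exists T)). Qed.

Lemma rip_adjoint T x y : rip (T x) y = rip x (adjoint T y).
Proof. by rewrite /rip adjointE. Qed.

End adjoint.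

(** * Powers of a contraction and the asymptotic limit *)

Section asymptotic_limit.
Context {R : realType} {H : hilbertType R}.
Implicit Types (x y z : H) (S T A : boundedOp H) (n m k : nat).

Definition nsq_contraction T := forall x, nsq (T x) <= nsq x.

(** The square of [y - T (T* y)] equals [nsq y - 2 * nsq (T* y) + nsq (T (T* y))], and the last term
    is at most [nsq (T* y)]. *)
Lemma nsq_adjoint T : nsq_contraction T -> nsq_contraction (adjoint T).
Proof.
move=> T1 y; have := nsq_ge0 (y - T (adjoint T y)).
rewrite nsqB (ripC y) rip_adjoint -/(nsq _); have := T1 (adjoint T y); lra.
Qed.

Lemma pow_opE T n x : pow_op T n x = iter n T x.
Proof. by elim: n => //= n <-. Qed.

Lemma pow_opD T m n x : pow_op T (m + n) x = pow_op T m (pow_op T n x).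
Proof. by rewrite !pow_opE iterD. Qed.

Lemma pow_opSr T n x : pow_op T n.+1 x = pow_op T n (T x).
Proof. by rewrite !pow_opE iterSr. Qed.

Lemma nsq_pow_op T n : nsq_contraction T -> nsq_contraction (pow_op T n).
Proof.
move=> T1; elim: n => [|n IH] x; first exact: lexx.
exact: le_trans (T1 _) (IH x).
Qed.

Lemma rip_pow_adjoint T n x y :
  rip (pow_op T n x) y = rip x (pow_op (adjoint T) n y).
Proof.
rewrite !pow_opE; elim: n y => // n IH y.
by rewrite iterS rip_adjoint IH -iterSr.
Qed.

Let W T n x := pow_op (adjoint T) n (pow_op T n x).

Let rip_W T n x y : rip (W T n x) y = rip (pow_op T n x) (pow_op T n y).
Proof. by rewrite ripC [RHS]ripC rip_pow_adjoint. Qed.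

(* Factor out [adjoint T ^ m], which leaves [nsq (y - W T k y)] with
   [y = T ^ m x]. *)
Let nsq_W_sub T m k x : nsq_contraction T ->
  nsq (W T m x - W T (m + k) x) <=
    nsq (pow_op T m x) - nsq (pow_op T (m + k) x).
Proof.
move=> T1; rewrite /W pow_opD (addnC m k) !pow_opD -linearB.
apply: le_trans (nsq_pow_op m (nsq_adjoint T1) _) _.
move: (pow_op T m x) => y; rewrite nsqB (ripC y) -/(W T k y) rip_W -/(nsq _).
have := nsq_pow_op k (nsq_adjoint T1) (pow_op T k y); rewrite -/(W T k y); lra.
Qed.

Let W_cvg T x : nsq_contraction T -> exists l : H, W T n x @[n --> \oo] --> l.
Proof.
move=> T1; apply: cauchy_nsq_cvg => e e0.
pose E := range (fun n => nsq (pow_op T n x)).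
have infE : has_inf E.
  split; first by exists (nsq (pow_op T 0 x)), 0%N.
  by exists 0 => _ [n _ <-]; exact: nsq_ge0.
(* From an index within [e] of the infimum on, [nsq (pow_op T n x)] can drop by less than [e]. *)
have [_ [m _ <-] me] := inf_adherent e0 infE.
exists m => n mn; rewrite -(subnKC mn).
apply: le_lt_trans (nsq_W_sub _ _ _ T1) _.
have : inf E <= nsq (pow_op T (m + (n - m)) x).
  by apply: ge_inf; [case: infE | exists (m + (n - m))%N].
lra.
Qed.

Lemma sot_limit_exists T : nsq_contraction T -> exists A : boundedOp H,
  sot_cvg (fun n => comp_op (pow_op (adjoint T) n) (pow_op T n)) A.
Proof.
move=> T1; have /choice[a aE] x := W_cvg x T1.
have alin : linear a.
  move=> c x y.
  have : W T n (c *: x + y) @[n --> \oo] --> c *: a x + a y.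
    under eq_fun do rewrite /W !linearP.
    exact: cvgD (cvgZl_tmp (aE x)) (aE y).
  exact: norm_cvg_unique (aE _).
pose a' : {linear H -> H} := HB.pack a (GRing.isLinear.Build _ _ _ _ _ alin).
have ab : bounded_near a' (nbhs (0 : H)).
  apply/bounded_nsqP; exists 1 => // x /=; rewrite mul1r.
  (* One argument is kept fixed at [a x], so the limit is that of [rip (W T n x) (a x)], where
     [2 * rip u v <= nsq u + nsq v] applies. *)
  have : rip (a x) (a x) <= (nsq x + nsq (a x)) / 2.
    apply: (cvgr_to_le (cvg_rip (y := a x) (aE x))); apply: nearW => n.
    have := nsq_ge0 (W T n x - a x); rewrite nsqB.
    have := nsq_pow_op n (nsq_adjoint T1) (pow_op T n x).
    have := nsq_pow_op n T1 x; rewrite -/(W T n x); lra.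
  rewrite -/(nsq (a x)); lra.
by exists (BoundedOp ab).
Qed.

(** Existence of the strong limit makes the choice by [get] meaningful. All later facts on the
    asymptotic limit come from this weak form. *)
Lemma cvg_rip_pow T x y : nsq_contraction T ->
  rip (pow_op T n x) (pow_op T n y) @[n --> \oo] -->
    rip (asymptotic_limit T x) y.
Proof.
move=> T1; have := getPex (sot_limit_exists T1).
move=> /(_ x)/(cvg_rip (y := y)); apply: cvg_trans; apply: near_eq_cvg.
by apply: nearW => n; rewrite -rip_W.
Qed.

(** Both sides are limits of [nsq (pow_op T n x)], the left one with the index shifted by one. *)
Lemma asymptotic_limit_isometry T x : nsq_contraction T ->
  rip (asymptotic_limit T (T x)) (T x) = rip (asymptotic_limit T x) x.
Proof.
move=> T1; have := cvg_rip_pow (x := T x) (y := T x) T1.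
under eq_fun do rewrite -!pow_opSr.
move=> h; apply: (norm_cvg_unique (V := R^o) h).
have := cvg_rip_pow (x := x) (y := x) T1; rewrite -cvg_shiftS; exact.
Qed.

Lemma rip_asymptotic_limit_le T x : nsq_contraction T ->
  rip (asymptotic_limit T x) x <= nsq x.
Proof.
move=> T1; apply: (cvgr_to_le (cvg_rip_pow (x := x) (y := x) T1)).
by apply: nearW => n; exact: nsq_pow_op.
Qed.

(** Needed because the order on [R[i]] also constrains imaginary parts. *)
Lemma Im_inner_asymptotic_limit T x : nsq_contraction T ->
  complex.Im (inner (asymptotic_limit T x) x) = 0.
Proof.
move=> T1; rewrite Im_inner.
have := cvg_rip_pow (x := x) (y := 'i%C *: x) T1.
move=> /(norm_cvg_unique (V := R^o)); apply => /=.
under eq_fun => n.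
  have -> : rip (pow_op T n x) (pow_op T n ('i%C *: x)) = 0.
    rewrite linearZ /=; move: (pow_op T n x) => y.
    (* Moving [i] across changes the sign while [rip] is symmetric, so the value is its own
       negative. *)
    by have := ripil y y; rewrite ripC; lra.
  over.
exact: cvg_cst.
Qed.

End asymptotic_limit.

(** * Comparison for the product *)

Theorem theorem5 (R : realType) (H : hilbertType R) (T1 T2 A : boundedOp H)
    (hT1 : contractive T1) (hT2 : contractive T2)
    (hA1 : asymptotic_limit T1 = A) (hA2 : asymptotic_limit T2 = A) :
  op_le A (asymptotic_limit (comp_op T1 T2)).
Proof.
have c1 : nsq_contraction T1 by move=> x; exact: contractive_nsq.
have c2 : nsq_contraction T2 by move=> x; exact: contractive_nsq.
set T := comp_op T1 T2.
have cT : nsq_contraction T by move=> x; exact: le_trans (c1 _) (c2 x).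
move=> x.
have inv n : rip (A x) x = rip (A (pow_op T n x)) (pow_op T n x).
  elim: n => //= n ->; set y := pow_op T n x.
  (* The common limit allows reading [A] first as the limit of [T2], then as that of [T1], in the
     order in which [T] applies them. *)
  rewrite -[in LHS]hA2 -asymptotic_limit_isometry// hA2.
  by rewrite -[in LHS]hA1 -asymptotic_limit_isometry// hA1.
have le : rip (A x) x <= rip (asymptotic_limit T x) x.
  (* The constant [rip (A x) x] is a lower bound for every [nsq (pow_op T n x)]. *)
  apply: (cvgr_to_ge (cvg_rip_pow (x := x) (y := x) cT)); apply: nearW => n.
  by rewrite (inv n) -[in leLHS]hA1; exact: rip_asymptotic_limit_le.
rewrite (linearBl inner x (asymptotic_limit T x) (A x) :
  inner (asymptotic_limit T x - A x) x =
  inner (asymptotic_limit T x) x - inner (A x) x).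
(* The order on [R[i]] asks for equal imaginary parts, here both zero, and ordered real parts, which
   is [le]. *)
rewrite subr_ge0 lecE -[in inner (A x) x]hA1.
by rewrite !Im_inner_asymptotic_limit// eqxx hA1.
Qed.
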